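(* Let $R$ be a ring with proper involution $*$, let $m\ge 1$ be an integer and let $a,b\in R^{\overline{W}_m}$. If $ab=0$, $ba=0$ and $a^*b=0$, then $a+b\in R^{\overline{W}_m}$. In this case, $$(a+b)^{\overline{W}_m}=a^{\overline{W}_m}+b^{\overline{W}_m}.$$
   Context: Rings are associative with identity and $\mathbb{N}$ is the set of positive integers. An involution $*$ on $R$ satisfies $(x+y)^*=x^*+y^*$, $(xy)^*=y^*x^*$, $(x^* )^*=x$; it is proper if $x^*x=0$ implies $x=0$. An element $a\in R$ has an $m$-weak group inverse if there exist $x\in R$ and $k\in\mathbb{N}$ with $ax^2=x$, $xa^{k+1}=a^k$ and $(a^k)^*a^{m+1}x=(a^k)^*a^m$; such an $x$ is unique if it exists and is denoted $a^{\overline{W}_m}$. $R^{\overline{W}_m}$ is the set of elements of $R$ having an $m$-weak group inverse. *)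

(* Defs.v *)
From mathcomp Require Import all_boot all_order all_algebra.
From mathcomp Require Import boolp classical_sets.

Set Implicit Arguments.
Unset Strict Implicit.
Unset Printing Implicit Defensive.

Import GRing.Theory.
Local Open Scope ring_scope.

(* [pzRingType] (rather than [nzRingType]) does not exclude the zero ring. *)
Record is_involution (R : pzRingType) (star : R -> R) : Prop := IsInvolution {
  involutionD : forall x y : R, star (x + y) = star x + star y;
  involutionM : forall x y : R, star (x * y) = star y * star x;
  involutionK : forall x : R, star (star x) = x
}.

Definition is_proper (R : pzRingType) (star : R -> R) : Prop :=
  forall x : R, star x * x = 0 -> x = 0.

Definition is_mweak_group_inverse (R : pzRingType) (star : R -> R) (m : nat)
    (a x : R) : Prop :=
  exists k : nat,
    [/\ (0 < k)%N,
        a * x ^+ 2 = x,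
        x * a ^+ k.+1 = a ^+ k
      & star (a ^+ k) * a ^+ m.+1 * x = star (a ^+ k) * a ^+ m].

Definition mweak_group_invertible (R : pzRingType) (star : R -> R) (m : nat)
    (a : R) : Prop :=
  exists x : R, is_mweak_group_inverse star m a x.

(* The inverse as a total function, with junk value 0 where there is none;
   [mweak_group_inverse_uniq] makes the choice irrelevant elsewhere. *)
Definition mweak_group_inverse (R : pzRingType) (star : R -> R) (m : nat)
    (a : R) : R :=
  xget 0 [set x : R | is_mweak_group_inverse star m a x]%classic.

Lemma mweak_group_inverse_uniq (R : pzRingType) (star : R -> R) (m : nat)
    (a x y : R) :
  is_involution star -> is_proper star ->
  is_mweak_group_inverse star m a x -> is_mweak_group_inverse star m a y ->
  x = y.
Proof.
move=> [sD sM sK] sP [k [k0 x2 xk xs]] [l [l0 y2 yl ys]].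
have powE z n : a * z ^+ 2 = z -> a ^+ n * z ^+ n.+1 = z.
  move=> z2; elim: n => [|n IH]; first by rewrite expr0 mul1r expr1.
  have -> : a ^+ n.+1 * z ^+ n.+2 = a ^+ n * (a * z ^+ 2) * z ^+ n.
    by rewrite exprSr (_ : z ^+ n.+2 = z ^+ 2 * z ^+ n) ?mulrA // -exprD.
  by rewrite z2 -mulrA -exprS.
have idE z n d : z * a ^+ n.+1 = a ^+ n ->
    z * a ^+ (n + d).+1 = a ^+ (n + d).
  by move=> zn; rewrite -addSn exprD mulrA zn -exprD.
have stE z n d : star (a ^+ n) * a ^+ m.+1 * z = star (a ^+ n) * a ^+ m ->
    star (a ^+ (n + d)) * a ^+ m.+1 * z = star (a ^+ (n + d)) * a ^+ m.
  by move=> zn; rewrite exprD sM -!mulrA; congr (_ * _); rewrite mulrA zn.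
set n := (k + l)%N.
have xn := idE _ _ l xk; rewrite -/n in xn.
have xsn := stE _ _ l xs; rewrite -/n in xsn.
have ysn := stE _ _ k ys; rewrite addnC -/n in ysn.
have dE : x - y = a ^+ n * (x ^+ n.+1 - y ^+ n.+1) by rewrite mulrBr !powE.
have cE : a ^+ m.+1 * (x - y) = 0.
  apply: sP.
  have {1}-> : a ^+ m.+1 * (x - y)
      = a ^+ n * (a ^+ m.+1 * (x ^+ n.+1 - y ^+ n.+1)).
    by rewrite dE !mulrA -!exprD addnC.
  by rewrite sM -mulrA [X in _ * X]mulrA mulrBr xsn ysn subrr mulr0.
have canE j : x ^+ j * a ^+ (j + n) = a ^+ n.
  elim: j => [|j IH]; first by rewrite mul1r.
  rewrite exprSr -mulrA [X in _ * (x * X)](_ : _ = a ^+ (n + j).+1); last first.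
    by rewrite addSn addnC.
  by rewrite idE // addnC.
apply/eqP; rewrite -subr_eq0; apply/eqP.
by rewrite dE -(canE m.+1) exprD -!mulrA -dE cE mulr0.
Qed.

(* Main.v *)
Require Import Defs.
From mathcomp Require Import all_boot all_order all_algebra.
From mathcomp Require Import classical_sets.

Set Implicit Arguments.
Unset Strict Implicit.
Unset Printing Implicit Defensive.

Import GRing.Theory.
Local Open Scope ring_scope.

(** Let [x] and [y] be the inverses of [a] and [b]. Since [x = a x^2] lies in [aR]
    and [y] in [bR], we have [a y = b x = 0]. The relation [x b = 0] comes from
    uniqueness: [x - x b] is again an m-weak group inverse of [a]. With the
    symmetric relation [y a = 0], all cross terms in the equations defining an
    inverse of [a + b] vanish. *)

Lemma mulr_expl_eq0 (R : pzRingType) (c d : R) (n : nat) :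
  (0 < n)%N -> c * d = 0 -> c ^+ n * d = 0.
Proof. by case: n => // n _ cd; rewrite exprSr -mulrA cd mulr0. Qed.

Lemma mulr_expr_eq0 (R : pzRingType) (c d : R) (n : nat) :
  (0 < n)%N -> c * d = 0 -> c * d ^+ n = 0.
Proof. by case: n => // n _ cd; rewrite exprS mulrA cd mul0r. Qed.

(** Every mixed monomial contains [a * b] or [b * a]. The exponent must be positive: at [n = 0] the
    two sides are [1] and [1 + 1]. *)
Lemma exprD_orthogonal (R : pzRingType) (a b : R) (n : nat) :
  (0 < n)%N -> a * b = 0 -> b * a = 0 -> (a + b) ^+ n = a ^+ n + b ^+ n.
Proof.
case: n => // n _ ab ba; elim: n => [|n IH]; first by rewrite !expr1.
rewrite exprS IH mulrDl !mulrDr -!exprS.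
by rewrite (mulr_expr_eq0 _ ab) // (mulr_expr_eq0 _ ba) // addr0 add0r.
Qed.

Section Involution.

Variables (R : pzRingType) (star : R -> R).
Hypothesis star_inv : is_involution star.

Lemma involution0 : star 0 = 0.
Proof.
have [sD _ _] := star_inv.
by apply: (addrI (star 0)); rewrite -sD !addr0.
Qed.

(** As [star] reverses products, the rightmost factor of [star (a ^+ n)] is [star a], which meets
    [b]. *)
Lemma involution_expr_mul_eq0 (a b : R) (n : nat) :
  (0 < n)%N -> star a * b = 0 -> star (a ^+ n) * b = 0.
Proof.
have [_ sM _] := star_inv.
case: n => // n _ ab; elim: n => [|n IH]; first by rewrite expr1.
by rewrite exprS sM -mulrA ab mulr0.
Qed.

Lemma involution_mul_eq0_sym (a b : R) : star a * b = 0 -> star b * a = 0.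
Proof.
have [_ sM sK] := star_inv.
by move=> ab; rewrite -[star b * a]sK sM sK ab involution0.
Qed.

Variable m : nat.

Lemma mul_mweak_group_inverse_eq0 (a b x : R) :
  b * a = 0 -> is_mweak_group_inverse star m a x -> b * x = 0.
Proof. by move=> ba [k [_ x2 _ _]]; rewrite -x2 mulrA ba mul0r. Qed.

Lemma mweak_group_inverse_mul_eq0 (a b x : R) :
  is_proper star -> (0 < m)%N -> a * b = 0 -> b * a = 0 ->
  is_mweak_group_inverse star m a x -> x * b = 0.
Proof.
move=> sP m0 ab ba xI.
have bx := mul_mweak_group_inverse_eq0 ba xI.
have xbI : is_mweak_group_inverse star m a (x - x * b).
  have [k [k0 x2 xk xs]] := xI; exists k; split=> //.
  (* Since [b * x = 0], also [b * (x - x * b) = 0], so only [x * (x - x * b)] survives in the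
     square. *)
  - have -> : (x - x * b) ^+ 2 = x ^+ 2 - x ^+ 2 * b.
      rewrite !expr2 mulrBl -[x * b * _]mulrA [b * _]mulrBr [b * (_ * _)]mulrA.
      by rewrite bx mul0r subr0 mulr0 subr0 mulrBr mulrA.
    by rewrite mulrBr mulrA x2.
  - by rewrite mulrBl -mulrA (mulr_expr_eq0 _ ba) // mulr0 subr0.
  (* The third equation for [x] turns the correction term into [star (a ^+ k) * a ^+ m * b], which
     is zero because [0 < m]. *)
  - rewrite mulrBr [_ * (x * b)]mulrA xs -[_ * b]mulrA.
    by rewrite (mulr_expl_eq0 m0 ab) mulr0 subr0.
have xE := mweak_group_inverse_uniq star_inv sP xbI xI.
by apply: oppr_inj; apply: (addrI x); rewrite xE oppr0 addr0.
Qed.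

(** Multiply the first equation by [a ^+ d] on the right and the second by [star (a ^+ d)] on the
    left. This lets two inverses share one exponent. *)
Lemma mweak_group_inverse_exponentD (a x : R) (k d : nat) :
  x * a ^+ k.+1 = a ^+ k ->
  star (a ^+ k) * a ^+ m.+1 * x = star (a ^+ k) * a ^+ m ->
  x * a ^+ (k + d).+1 = a ^+ (k + d) /\
  star (a ^+ (k + d)) * a ^+ m.+1 * x = star (a ^+ (k + d)) * a ^+ m.
Proof.
have [_ sM _] := star_inv => xk xs; split.
  by rewrite -addSn exprD mulrA xk -exprD.
by rewrite exprD sM -!mulrA; congr (_ * _); rewrite mulrA.
Qed.

Lemma is_mweak_group_inverseD (a b x y : R) :
  is_proper star -> (0 < m)%N ->
  a * b = 0 -> b * a = 0 -> star a * b = 0 ->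
  is_mweak_group_inverse star m a x -> is_mweak_group_inverse star m b y ->
  is_mweak_group_inverse star m (a + b) (x + y).
Proof.
have [sD _ _] := star_inv => sP m0 ab ba sab xI yI.
have sba := involution_mul_eq0_sym sab.
have bx := mul_mweak_group_inverse_eq0 ba xI.
have ay := mul_mweak_group_inverse_eq0 ab yI.
have xb := mweak_group_inverse_mul_eq0 sP m0 ab ba xI.
have ya := mweak_group_inverse_mul_eq0 sP m0 ba ab yI.
(* Here [x] plays the role of the left annihilator: [x * y = x * b * y ^+ 2 = 0]. *)
have xy := mul_mweak_group_inverse_eq0 xb yI.
have yx := mul_mweak_group_inverse_eq0 ya xI.
have [k [k0 x2 xk xs]] := xI; have [l [l0 y2 yl ys]] := yI.
(* Both exponents are raised to the common value [k + l], the witness for [a + b]. *)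
have [xn xsn] := mweak_group_inverse_exponentD l xk xs.
have [yn ysn] := mweak_group_inverse_exponentD k yl ys.
rewrite addnC in yn ysn.
have n0 : (0 < k + l)%N by rewrite addn_gt0 k0.
exists (k + l)%N; split=> //.
- rewrite (exprD_orthogonal _ xy yx) // mulrDl !mulrDr x2 y2.
  by rewrite (mulr_expr_eq0 _ ay) // (mulr_expr_eq0 _ bx) // addr0 add0r.
- rewrite !(exprD_orthogonal _ ab ba) // mulrDl !mulrDr xn yn.
  by rewrite (mulr_expr_eq0 _ xb) // (mulr_expr_eq0 _ ya) // addr0 add0r.
(* Used below for [i = m.+1] and [i = m], the latter being allowed by [0 < m]. The mixed terms
   vanish by [sab] and its adjoint [sba]. *)
have sE i : (0 < i)%N ->
    star ((a + b) ^+ (k + l)) * (a + b) ^+ i =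
    star (a ^+ (k + l)) * a ^+ i + star (b ^+ (k + l)) * b ^+ i.
  move=> i0; rewrite !(exprD_orthogonal _ ab ba) // sD mulrDl !mulrDr.
  rewrite (mulr_expr_eq0 i0 (involution_expr_mul_eq0 n0 sab)).
  by rewrite (mulr_expr_eq0 i0 (involution_expr_mul_eq0 n0 sba)) addr0 add0r.
(* The remaining mixed terms end in [a ^+ m.+1 * y] or [b ^+ m.+1 * x]. *)
rewrite !sE // mulrDl !mulrDr xsn ysn -![_ * _ ^+ m.+1 * _]mulrA.
by rewrite (mulr_expl_eq0 _ ay) // (mulr_expl_eq0 _ bx) // !mulr0 addr0 add0r.
Qed.

(** Given a witness, [xget] returns a member of the set rather than its default [0]. *)
Lemma mweak_group_inverseP (a : R) :
  mweak_group_invertible star m a ->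
  is_mweak_group_inverse star m a (mweak_group_inverse star m a).
Proof. by case=> x xI; exact: (xgetI 0 xI). Qed.

End Involution.

Theorem theorem2p9 (R : pzRingType) (star : R -> R)
    (star_inv : is_involution star) (star_proper : is_proper star)
    (m : nat) (m_gt0 : (1 <= m)%N) (a b : R)
    (ha : mweak_group_invertible star m a)
    (hb : mweak_group_invertible star m b)
    (hab : a * b = 0) (hba : b * a = 0) (hsab : star a * b = 0) :
  mweak_group_invertible star m (a + b) /\
  mweak_group_inverse star m (a + b) =
    mweak_group_inverse star m a + mweak_group_inverse star m b.
Proof.
have abI := is_mweak_group_inverseD star_inv star_proper m_gt0
  hab hba hsab (mweak_group_inverseP ha) (mweak_group_inverseP hb).
have abV : mweak_group_invertible star m (a + b) by eexists; exact: abI.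
split=> //; apply: mweak_group_inverse_uniq star_inv star_proper _ abI.
exact: mweak_group_inverseP abV.
Qed.
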